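(* Let $m\ge2$. For every integer $t$ with $1\le t$ and $2t\le m$, the minimum distance of the code $C_{symm}(2t,m)$ is $W_1(2t,m)=W_2(2t,m)$. For every integer $t$ with $0\le t$ and $2t+1\le m$, the minimum distance of the code $C_{symm}(2t+1,m)$ is $W_2^{1}(2t+1,m)$.
   Context: $m$ is a positive integer, $q$ is a power of an odd prime, $\mathbb{F}_q$ is the finite field with $q$ elements, and $\mathbb{X}$ is the space of $m\times m$ symmetric matrices over $\mathbb{F}_q$. For $0\le a\le m$ write $\{A\in\mathbb{X}:\operatorname{rank}(A)\le a\}=\{A_1,\dots,A_N\}$; the code $C_{symm}(a,m)\subseteq\mathbb{F}_q^N$ consists of the codewords $c_B=(\mathrm{Tr}(BA_1),\dots,\mathrm{Tr}(BA_N))$, $B\in\mathbb{X}$ (equivalently, evaluations at all symmetric matrices of rank at most $a$ of homogeneous linear forms in the entries $x_{ij}$, $i\le j$). The minimum distance is the minimum Hamming weight of a nonzero codeword. Types: a symmetric matrix of odd rank has type $0$. A symmetric matrix of even rank $2s$ has type $1$ (hyperbolic) if the nondegenerate quadratic form it induces modulo its radical is hyperbolic (an orthogonal sum of $s$ hyperbolic planes), and type $-1$ (elliptic) otherwise. Weights: for $B\in\mathbb{X}$ of rank $k$ and type $\tau$, $W_k^{\tau}(a,m)$ denotes the Hamming weight of $c_B\in C_{symm}(a,m)$, i.e. $|\{A\in\mathbb{X}:\operatorname{rank}(A)\le a,\ \mathrm{Tr}(BA)\ne0\}|$; it depends only on $k,\tau$ (and $a,m,q$), not on $B$. The superscript $\tau$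 is omitted when $k$ is odd, and also when $a$ is even, since then the weight does not depend on $\tau$. *)

(* Defs.v *)
From HB Require Import structures.
From mathcomp Require Import all_boot all_order all_algebra.

Set Implicit Arguments.
Unset Strict Implicit.
Unset Printing Implicit Defensive.

Import GRing.Theory.
Local Open Scope ring_scope.

Section Codes.
Variables (F : finFieldType) (N : nat).
Implicit Types (c : 'rV[F]_N) (C : {set 'rV[F]_N}).

Definition hamming_weight c : nat := #|[set i | c 0 i != 0]|.

(* A relation rather than a function, so that no value has to be invented for
   the zero code. *)
Definition has_min_distance C (d : nat) : Prop :=
  (exists c, [/\ c \in C, c != 0 & hamming_weight c = d]) /\
  (forall c, c \in C -> c != 0 -> (d <= hamming_weight c)%N).

End Codes.

Section SymmetricCode.
Variables (F : finFieldType) (m : nat).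
Implicit Types A B : 'M[F]_m.

Definition symmx : {set 'M[F]_m} := [set A | A \is symmetricmx].

Definition symmx_le (a : nat) : {set 'M[F]_m} :=
  [set A in symmx | (\rank A <= a)%N].

(* The coordinates are indexed by the enumeration A_i = enum_val i of
   symmx_le a. *)
Definition codeword (a : nat) B : 'rV[F]_#|symmx_le a| :=
  \row_i \tr (B *m enum_val i).

Definition Csymm (a : nat) : {set 'rV[F]_#|symmx_le a|} :=
  [set codeword a B | B in symmx].

Definition qform B (v : 'rV[F]_m) : F := (v *m B *m v^T) 0 0.

(* For symmetric B of rank 2s: the rows e_i, f_i (i < s) of e and f span the
   row space modulo the radical kermx B; as the quotient has dimension
   \rank B = 2s, their classes form a basis of it. In that basis the induced
   form is the orthogonal sum of the s hyperbolic planes x_i y_i. *)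
Definition hyperbolic B : bool :=
  [exists e : 'M[F]_((\rank B)./2, m), exists f : 'M[F]_((\rank B)./2, m),
    (1%:M <= col_mx e f + kermx B)%MS &&
    [forall x : 'rV[F]_((\rank B)./2), forall y : 'rV[F]_((\rank B)./2),
      qform B (x *m e + y *m f) == \sum_i x 0 i * y 0 i]].

Definition symm_type B : int :=
  if odd (\rank B) then 0 else if hyperbolic B then 1 else -1.

Definition symmx_rank (k : nat) : {set 'M[F]_m} :=
  [set B in symmx | \rank B == k].

Definition symmx_rank_type (k : nat) (tau : int) : {set 'M[F]_m} :=
  [set B in symmx_rank k | symm_type B == tau].

(* "W_k(a,m) = w" (no superscript) and "W_k^tau(a,m) = w": such B exist, and
   all of them have a codeword of weight w. *)
Definition is_W (k a w : nat) : Prop :=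
  (exists B, B \in symmx_rank k) /\
  (forall B, B \in symmx_rank k -> hamming_weight (codeword a B) = w).

Definition is_W_type (k : nat) (tau : int) (a w : nat) : Prop :=
  (exists B, B \in symmx_rank_type k tau) /\
  (forall B, B \in symmx_rank_type k tau -> hamming_weight (codeword a B) = w).

End SymmetricCode.

Arguments Csymm : clear implicits.
Arguments is_W : clear implicits.
Arguments is_W_type : clear implicits.

(* Main.v *)
Require Import Defs.
From mathcomp Require Import all_boot all_order all_fingroup all_algebra.
From mathcomp Require Import all_solvable all_field all_character.
From mathcomp Require Import ring zify.

(** Let [chi] be a nontrivial additive character of [F], let [q = #|F|], and
    put [S(B) = char_sum a B], the sum of [chi (\tr (B *m A))] over the
    symmetric [A] of rank at most [a].  The set of these [A] is stable under
    scaling, so the sums for [l *: B], [l != 0], all equal [S(B)], and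
    orthogonality of characters gives [q * weight = (q - 1) * (N - S(B))],
    with [N] the length of the code ([weight_char_sum]).  Hence codewords of
    minimal weight are those with the largest [S(B)].

    As [F] has odd characteristic, a symmetric [B] of rank at least 2 is
    congruent to [b (+) c (+) B1] with [b], [c] nonzero ([symmx_split2]), and
    [S] is invariant under congruence.  The heart of the proof is the formula
      [S (b (+) c (+) B1) = (s * q) ^+ a * pair_sum a B1],
    where [s = 1] or [s = -1] according as the plane [b x^2 + c y^2] is
    isotropic or not, and [pair_sum a B1] is the sum of
    [chi (\tr (B1 *m A))] over the symmetric [A], two sizes smaller, whose
    rank is [a] or [a - 1].  The triangle inequality now gives
      [`|S(B)| <= q ^+ a * pair_sum a 0 =: char_sum_max],
    with [S(B) = char_sum_max] when [B] has rank 2 and either [a] is even (as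
    [s ^+ a = 1]) or [B] is hyperbolic ([s = 1]).

    The formula comes from peeling off one row and column of [A] at a time.
    Write [A] as the matrix [A'] bordered by a row [u] and a corner [x].  If
    [u] is outside the row space of [A'], then [\rank A = \rank A' + 2] for
    every [x], so that summing [chi (b * x)] over [x] gives 0.  If
    [u = w *m A'], then [A] is congruent to [y (+) A'] with
    [y = x - qform A' w].  Summing over [w] produces the quadratic exponential
    sum [theta] of [A'], normalised to [norm_theta], which a second peeling
    evaluates ([char_sum_block], [twisted_sum_block]).  No individual Gauss
    sum has to be evaluated: only products [gauss b * gauss c = s * q] occur
    ([gauss_mul]), and they give
    [norm_theta b A * norm_theta c A = (s * q) ^+ \rank A]
    ([norm_theta_mul]).

    For [B] of rank 1 a single peeling gives
    [S(B) = twisted_sum b a 0], the sum of [norm_theta b A] over all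
    symmetric [A] of rank [a].  The same bordering yields recursions in the
    size for this sum and for [pair_sum a 0]; comparing them shows that
    [S(B) = char_sum_max] for [a] even and [S(B) = 0] for [a] odd
    ([twisted_sum_even], [twisted_sum_odd]). *)

Set Implicit Arguments.
Unset Strict Implicit.
Unset Printing Implicit Defensive.

Import Order.TTheory GRing.Theory Num.Theory.

Section MinimumDistance.

Local Open Scope ring_scope.

Variable F : finFieldType.

(** * Additive characters and Gauss sums *)

(** The additive group of [F] is abelian and nontrivial, so it has a
    nontrivial linear character. *)
Lemma additive_char_exists :
  exists chi : F -> algC,
    [/\ {morph chi : x y / x + y >-> x * y}, forall x, `|chi x| = 1
      & exists x, chi x != 1].
Proof.
have ab : abelian [set: F].
  by apply/centsP=> x _ y _; apply: addrC.
have nt : [set: F] != 1%g :> {set F}.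
  apply: contraTneq (finNzRing_gt1 F) => e.
  by rewrite -cardsT e cards1.
have [i lin ne1] := solvable_has_lin_char (G := [set: F]%G) nt (abelian_sol ab).
exists ('chi_i); split.
- by move=> x y; apply: (lin_charM lin); rewrite inE.
- by move=> x; apply: (normC_lin_char lin); rewrite inE.
apply/existsP; apply: contraR ne1; rewrite negb_exists => /forallP h.
by apply/eqP/cfunP=> x; rewrite cfun1E inE; apply/eqP; have := h x; rewrite negbK.
Qed.

Hypothesis q_odd : odd #|F|.


Let two_neq0 : 2%:R != 0 :> F.
Proof.
(* Otherwise 1 has additive order 2, which must divide [#|F|]. *)
apply/negP=> /eqP h.
have d2 : (#[1%R : F]%g %| 2)%N by rewrite order_dvdn; apply/eqP; exact: h.
have dq : (#[1%R : F]%g %| #|F|)%N by rewrite -cardsT (order_dvdG (G := [set: F]%G)) ?inE.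
have : (#[1%R : F]%g %| gcdn 2 #|F|)%N by rewrite dvdn_gcd d2.
have /eqP -> : coprime 2 #|F| by rewrite coprime2n.
by rewrite dvdn1 order_eq1 => /eqP /(congr1 (fun x : F => x == 0)); rewrite oner_eq0 eqxx.
Qed.

Variable chi : F -> algC.
Hypotheses (chiD : {morph chi : x y / x + y >-> x * y})
  (chi_norm : forall x, `|chi x| = 1) (chi_nt : exists x, chi x != 1).

Local Notation q := (#|F|%:R : algC).

Let q_gt0 : 0 < q.
Proof. by rewrite ltr0n; apply/card_gt0P; exists 0. Qed.

Let q_neq0 : q != 0.
Proof. by rewrite gt_eqF. Qed.

Let chi0 : chi 0 = 1.
Proof.
have /(congr1 (fun x => x / chi 0)) := chiD 0 0.
by rewrite addr0 mulfK ?divff // -normr_eq0 chi_norm oner_eq0.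
Qed.

Lemma sum_chi b : \sum_x chi (b * x) = (b == 0)%:R * q.
Proof.
have [-> | nzb] := eqVneq b 0.
  rewrite mul1r (eq_bigr (fun=> 1)) => [|x _]; last by rewrite mul0r.
  by rewrite sumr_const.
have [y ny] := chi_nt; rewrite mul0r.
rewrite -(reindex_inj (h := *%R b) (P := predT) (F := chi)) /=; last exact: mulfI.
have e : \sum_x chi x = chi y * \sum_x chi x.
  by rewrite mulr_sumr (reindex_inj (addrI y)); apply: eq_bigr => x _; apply: chiD.
apply/eqP; have /eqP := e; rewrite -subr_eq0 -{1}(mul1r (\sum_x _)) -mulrBl mulf_eq0.
by rewrite subr_eq0 eq_sym (negPf ny).
Qed.

Definition gauss c : algC := \sum_x chi (c * x ^+ 2).

Lemma gauss0 : gauss 0 = q.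
Proof.
by have := sum_chi 0; rewrite eqxx mul1r => <-; apply: eq_bigr => x _; rewrite !mul0r.
Qed.

Definition sqr_fiber (b t : F) : {pred F} := [pred x | b * x ^+ 2 == t].

Lemma card_sqr_fiber_le b t : b != 0 -> (#|sqr_fiber b t| <= 2)%N.
Proof.
move=> nzb; have [-> //|] := posnP #|sqr_fiber b t|.
case/card_gt0P=> x; rewrite inE => /eqP xt.
have hs : sqr_fiber b t \subset [:: x; - x].
  apply/subsetP=> z; rewrite !inE -xt (inj_eq (mulfI nzb)) -subr_eq0 subr_sqr.
  by rewrite mulf_eq0 subr_eq0 addr_eq0.
by rewrite (leq_trans (subset_leq_card hs)) // (leq_trans (card_size _)).
Qed.

Lemma gauss_fiber b :
  gauss b = \sum_t #|sqr_fiber b t|%:R * chi t.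
Proof.
rewrite /gauss (partition_big (fun x => b * x ^+ 2) predT) //=.
apply: eq_bigr => t _; rewrite (eq_bigr (fun=> chi t)) => [|x /eqP-> //].
by rewrite sumr_const mulr_natl.
Qed.

Lemma sum_sqr_fiber b : (\sum_t #|sqr_fiber b t| = #|F|)%N.
Proof.
have <- : (\sum_(x : F) 1 = #|F|)%N by rewrite sum1_card.
rewrite [RHS](partition_big (fun x => b * x ^+ 2) predT) //=.
by apply: eq_bigr => t _; rewrite -sum1_card.
Qed.

(** The forms [b x^2] and [c x^2] never represent a common nonzero value, and
    each value is attained at most twice.  Hence the two fibre sizes over any
    [t] add up to at most 2; as they total [2 q] over the [q] values of [t],
    they always add up to exactly 2, and the sum is [2 * \sum_t chi t = 0]. *)
Lemma gauss_twist b c : b != 0 -> c != 0 -> (forall z, b * z ^+ 2 != c) ->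
  gauss b + gauss c = 0.
Proof.
move=> nzb nzc nsq.
pose N d t := #|sqr_fiber d t|.
have N2 t : (N b t + N c t <= 2)%N.
  have [e | npos] := posnP (N b t).
    by rewrite e card_sqr_fiber_le.
  have [e | npos'] := posnP (N c t).
    by rewrite e addn0 card_sqr_fiber_le.
  have [x] := card_gt0P npos; have [y] := card_gt0P npos'.
  rewrite !inE => /eqP yt /eqP xt.
  have [t0 | nzt] := eqVneq t 0.
    have N1 d : d != 0 -> (N d t <= 1)%N.
      move=> nzd; apply: leq_trans (card_size [:: 0]); apply: subset_leq_card.
      apply/subsetP=> z; rewrite !inE t0 mulf_eq0 (negPf nzd) /=.
      by rewrite expf_eq0.
    by rewrite (leq_add (N1 b nzb) (N1 c nzc)).
  have nzy : y != 0.
    by apply: contraNneq nzt => y0; rewrite -yt y0 expr0n mulr0.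
  have := nsq (x / y); rewrite expr_div_n mulrA xt -yt mulfK ?eqxx //.
  by rewrite expf_neq0.
have Neq t : (N b t + N c t = 2)%N.
  have : (\sum_t (2 - (N b t + N c t)) = 0)%N.
    apply/eqP; rewrite sumnB; last by move=> *; apply: N2.
    by rewrite big_split /= !sum_sqr_fiber sum_nat_const muln2 addnn subnn.
  move/eqP; rewrite sum_nat_eq0 => /forallP/(_ t) /=.
  by rewrite subn_eq0 => h; apply/eqP; rewrite eqn_leq N2 h.
rewrite !gauss_fiber -big_split /=.
rewrite (eq_bigr (fun t => 2%:R * chi (1 * t))) => [|t _].
  by rewrite -mulr_sumr sum_chi oner_eq0 mul0r mulr0.
by rewrite -mulrDl -natrD Neq mul1r.
Qed.

Definition isotropic_diag (b c : F) := [exists z : F, b * z ^+ 2 == - c].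

(** For nonzero [b] and [c] this is the quadratic character of [- b * c]. *)
Definition plane_sign b c : algC := if isotropic_diag b c then 1 else -1.

(** For an isotropic plane the form factors as [b (x - y) (x + y)] after
    rescaling [y], and the double sum collapses.  The anisotropic case reduces
    to the isotropic plane [b], [- b] by [gauss_twist]. *)
Lemma gauss_mul b c : b != 0 -> c != 0 ->
  gauss b * gauss c = plane_sign b c * q.
Proof.
move=> nzb nzc; rewrite /plane_sign.
have hyp z : z != 0 -> gauss b * gauss (- (b * z ^+ 2)) = q.
  move=> nzz; rewrite /gauss mulr_suml.
  transitivity (\sum_x \sum_y chi (b * (x ^+ 2 - y ^+ 2))).
    apply: eq_bigr => x _; rewrite mulr_sumr.
    rewrite [RHS](reindex_inj (h := *%R z)) /=; last exact: mulfI.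
    by apply: eq_bigr => y _; rewrite -chiD; congr chi; ring.
  transitivity (\sum_d \sum_y chi (b * d ^+ 2) * chi (2%:R * b * d * y)).
    rewrite exchange_big [RHS]exchange_big; apply: eq_bigr => y _ /=.
    rewrite (reindex_inj (addrI y)); apply: eq_bigr => d _.
    by rewrite -chiD; congr chi; ring.
  rewrite (bigD1 0) //= [X in _ + X]big1 ?addr0 => [|d nzd]; rewrite -mulr_sumr sum_chi.
    by rewrite expr0n !mulr0 eqxx chi0 !mul1r.
  by rewrite !mulf_eq0 (negPf nzb) (negPf nzd) (negPf two_neq0) mul0r mulr0.
case: ifPn => [/existsP[z /eqP e] | ].
  rewrite -[c]opprK -e hyp ?mul1r //.
  by apply: contraNneq nzc => z0; rewrite -oppr_eq0 -e z0 expr0n mulr0.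
rewrite negb_exists => /forallP h.
have : gauss (- b) + gauss c = 0.
  apply: gauss_twist; rewrite ?oppr_eq0 // => z; apply: contra (h z).
  by rewrite mulNr => /eqP <-; rewrite opprK.
rewrite addrC => /eqP; rewrite addr_eq0 => /eqP ->.
by rewrite mulrN mulN1r -{2}[b]mulr1 -(expr1n _ 2) hyp ?oner_eq0.
Qed.

Lemma card_isotropic b c : b != 0 -> c != 0 ->
  #|sqr_fiber b (- c)|%:R = 1 + plane_sign b c.
Proof.
move=> nzb nzc; rewrite /plane_sign; case: ifPn => [/existsP[z /eqP e] | h].
  have nzz : z != 0.
    by apply: contraNneq nzc => z0; rewrite -oppr_eq0 -e z0 expr0n mulr0.
  rewrite (eq_card (B := pred2 z (- z))) => [|x]; last first.
    rewrite !inE -e (inj_eq (mulfI nzb)) -subr_eq0 subr_sqr.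
    by rewrite mulf_eq0 subr_eq0 addr_eq0.
  have nz2 : z != - z.
    by rewrite -addr_eq0 -mulr2n -mulr_natl mulf_eq0 negb_or two_neq0.
  by rewrite card2 nz2 -natr1.
rewrite eq_card0 ?subrr // => x; rewrite !inE.
by move: h; rewrite negb_exists => /forallP/(_ x)/negPf.
Qed.

(** * Bordered symmetric matrices *)

Lemma mem_symmx n (A : 'M[F]_n) : (A \in symmx F n) = (A^T == A).
Proof.
by rewrite inE is_hermitianmxE expr0 scale1r map_mx_id // eq_sym.
Qed.

Lemma mem_symmx_le n a (A : 'M[F]_n) :
  (A \in symmx_le F n a) = (A \in symmx F n) && (\rank A <= a)%N.
Proof. by rewrite inE. Qed.

Lemma rank_congr n (P A : 'M[F]_n) : P \in unitmx ->
  \rank (P *m A *m P^T) = \rank A.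
Proof.
move=> uP; rewrite mxrankMfree ?row_free_unit ?unitmx_tr //.
by rewrite -mxrank_tr trmx_mul mxrankMfree ?row_free_unit ?unitmx_tr // mxrank_tr.
Qed.

Lemma symmx_congr n (P A : 'M[F]_n) : A \in symmx F n ->
  P *m A *m P^T \in symmx F n.
Proof.
by rewrite !mem_symmx => /eqP sA; rewrite !trmx_mul trmxK sA mulmxA.
Qed.

Lemma qform_congr n (P A : 'M[F]_n) w :
  qform (P *m A *m P^T) w = qform A (w *m P).
Proof. by rewrite /qform trmx_mul !mulmxA. Qed.

Definition bord n (x : F) (u : 'rV[F]_n) (A : 'M[F]_n) : 'M[F]_(1 + n) :=
  block_mx x%:M u u^T A.

Lemma bord_symmx n x (u : 'rV[F]_n) A :
  (bord x u A \in symmx F n.+1) = (A \in symmx F n).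
Proof.
rewrite !mem_symmx (tr_block_mx (m1 := 1) (n1 := 1)) tr_scalar_mx trmxK.
apply/eqP/eqP => [|-> //].
by case/(@eq_block_mx _ 1 n 1 n).
Qed.

Lemma symmx_bordE n (B : 'M[F]_(1 + n)) : B \in symmx F n.+1 ->
  B = bord (B 0 0) (ursubmx B) (drsubmx B).
Proof.
rewrite mem_symmx => /eqP sB; rewrite -[LHS]submxK /bord; congr block_mx.
  by rewrite [LHS]mx11_scalar !mxE !lshift0.
by rewrite -{1}sB trmx_ursub.
Qed.

Lemma sum_symmx_bord n (f : 'M[F]_(1 + n) -> algC) :
  \sum_(B in symmx F n.+1) f B =
  \sum_(A in symmx F n) \sum_u \sum_x f (bord x u A).
Proof.
rewrite (eq_bigr _ (fun A _ => pair_big predT predT (fun u x => f (bord x u A)))).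
rewrite pair_big_dep /=.
rewrite (reindex (fun p : 'M[F]_n * ('rV[F]_n * F) => bord p.2.2 p.2.1 p.1)) /=.
  by apply: eq_bigl => p; rewrite bord_symmx andbT.
exists (fun B : 'M[F]_(1 + n) => (drsubmx B, (ursubmx B, B 0 0))).
  move=> [A [u x]] _ /=; rewrite /bord block_mxKdr block_mxKur.
  by congr (_, (_, _)); rewrite -[0](lshift0 _ 0) block_mxEul mxE eqxx.
by move=> B sB /=; rewrite -symmx_bordE.
Qed.

Lemma rank_col_mx_notin m n (v : 'rV[F]_n) (M : 'M[F]_(m, n)) :
  ~~ (v <= M)%MS -> \rank (col_mx v M) = (\rank M).+1.
Proof.
move=> vM; rewrite -addsmxE.
have nzv : v != 0 by apply: contraNneq vM => ->; apply: sub0mx.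
have rv : \rank v = 1%N by rewrite rank_rV nzv.
have := mxrank_sum_cap v M; rewrite rv.
suff -> : \rank (v :&: M)%MS = 0%N by rewrite addn0 add1n.
apply/eqP; rewrite -leqn0 leqNgt; apply: contra vM => pos.
apply: submx_trans (capmxSr v M).
by rewrite -(geq_leqif (mxrank_leqif_sup (capmxSl v M))) rv.
Qed.

(** Adding the column [u] to [A] raises the rank by one, and so does adding the
    row [(x, u)] afterwards, whatever [x] is. *)
Lemma rank_bord_notin n x (u : 'rV[F]_n) A : A \in symmx F n ->
  ~~ (u <= A)%MS -> \rank (bord x u A) = (\rank A).+2.
Proof.
rewrite mem_symmx => /eqP sA uA; rewrite /bord block_mxEv.
rewrite rank_col_mx_notin; last first.
  apply: contra uA => /submxP[D]; rewrite mul_mx_row => /eq_row_mx[_ ->].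
  exact: submxMl.
by rewrite -mxrank_tr tr_row_mx trmxK sA rank_col_mx_notin.
Qed.

(** Completing the square: when the border lies in the row space of [A] it can
    be cleared by a congruence, which leaves [y] in the corner. *)
Lemma bord_in_congr n y (w : 'rV[F]_n) A : A \in symmx F n ->
  let P : 'M_(1 + n) := block_mx 1%:M w 0 1%:M in
  bord (qform A w + y) (w *m A) A = P *m block_mx y%:M 0 0 A *m P^T.
Proof.
rewrite mem_symmx => /eqP sA P; rewrite /P (tr_block_mx (m1 := 1) (n1 := 1)).
rewrite !mulmx_block !trmx1 !trmx0 !(mul1mx, mulmx1, mul0mx, mulmx0, addr0, add0r).
rewrite /bord trmx_mul sA; congr block_mx.
by rewrite [w *m A *m _]mx11_scalar -raddfD addrC.
Qed.

Lemma upper_unipotent_unitmx n (w : 'rV[F]_n) :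
  (block_mx 1%:M w 0 1%:M : 'M_(1 + n)) \in unitmx.
Proof. by rewrite unitmxE det_ublock !det1 mulr1 unitr1. Qed.

Lemma rank_bord_in n y (w : 'rV[F]_n) A : A \in symmx F n ->
  \rank (bord (qform A w + y) (w *m A) A) = ((y != 0%R) + \rank A)%N.
Proof.
move=> sA; rewrite bord_in_congr // rank_congr ?upper_unipotent_unitmx //.
by rewrite rank_diag_block_mx; congr addn; rewrite -scalemx1; have [->|nzy] := eqVneq y 0;
  rewrite ?scale0r ?mxrank0 // mxrank_scale_nz ?mxrank1.
Qed.

Lemma card_rowspace n (A : 'M[F]_n) :
  #|[pred u : 'rV[F]_n | (u <= A)%MS]| = (#|F| ^ \rank A)%N.
Proof.
have inj : injective (mulmxr (row_base A) : 'rV_(\rank A) -> 'rV_n).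
  by apply: (can_inj (g := mulmxr (pinvmx (row_base A)))) => v /=;
    rewrite mulmxKp ?row_base_free.
rewrite -[(#|F| ^ _)%N]/(#|F| ^ \rank A)%N -[\rank A in RHS]mul1n -card_mx.
rewrite -(card_image inj); apply: eq_card => u; rewrite inE -(eq_row_base A).
apply/submxP/imageP => [[v ->] | [v _ ->]]; first by exists v.
by exists v.
Qed.

(** Every fibre of [w |-> w *m A] is a translate of the kernel. *)
Lemma sum_rowspace n (A : 'M[F]_n) (f : 'rV[F]_n -> algC) :
  \sum_(u : 'rV[F]_n | (u <= A)%MS) f u =
  q ^+ \rank A / q ^+ n * \sum_w f (w *m A).
Proof.
pose c : algC := #|[pred w : 'rV[F]_n | w *m A == 0]|%:R.
have fib g : \sum_w g (w *m A) = c * \sum_(u : 'rV[F]_n | (u <= A)%MS) g u.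
  rewrite (partition_big (mulmxr A) (fun u : 'rV[F]_n => (u <= A)%MS)) /=; last first.
    by move=> w _; apply: submxMl.
  rewrite mulr_sumr; apply: eq_bigr => u /submxP[w0 ->].
  rewrite (reindex_inj (addrI w0)) /= (eq_bigr (fun=> g (w0 *m A))); last first.
    by move=> w /eqP ->.
  rewrite sumr_const /= mulr_natl; congr (_ *+ _); apply: eq_card => w.
  transitivity ((w0 + w) *m A == w0 *m A); first by [].
  by rewrite mulmxDl -subr_eq0 addrC addKr inE.
have cE : c * q ^+ \rank A = q ^+ n.
  have := fib (fun=> 1); rewrite !sumr_const card_rowspace card_mx mul1n.
  by rewrite !natrX => ->.
have e : q ^+ \rank A / q ^+ n * c = 1.
  by rewrite mulrAC [_ * c]mulrC cE divff ?expf_neq0.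
by rewrite fib mulrA e mul1r.
Qed.

(** The substitution [u = w *m A], [x = qform A w + y] is the one under which
    the bordered matrix becomes congruent to [y (+) A]. *)
Lemma sum_rowspace_split n (A : 'M[F]_n) (phi : 'rV[F]_n -> F -> algC) :
  \sum_u \sum_x phi u x =
  \sum_(u : 'rV[F]_n | ~~ (u <= A)%MS) \sum_x phi u x +
  q ^+ \rank A / q ^+ n * \sum_w \sum_y phi (w *m A) (qform A w + y).
Proof.
rewrite (bigID (fun u : 'rV[F]_n => (u <= A)%MS)) /= addrC; congr (_ + _).
rewrite sum_rowspace; congr (_ * _); apply: eq_bigr => w _.
exact: (reindex_inj (addrI (qform A w))).
Qed.

Lemma row_mx_scalarP n (v : 'rV[F]_(1 + n)) : exists z w, v = row_mx z%:M w.
Proof. by exists (lsubmx v 0 0), (rsubmx v); rewrite -mx11_scalar hsubmxK. Qed.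

Lemma sum_rV_split n (f : 'rV[F]_(1 + n) -> algC) :
  \sum_v f v = \sum_z \sum_w f (row_mx z%:M w).
Proof.
rewrite pair_big /= (reindex (fun p : F * 'rV[F]_n => row_mx p.1%:M p.2)) //=.
exists (fun v : 'rV[F]_(1 + n) => (v 0 0, rsubmx v)) => [[z w] _ | v _] /=.
  rewrite row_mxKr; congr (_, _).
  by have := row_mxEl (z%:M : 'M_1) w 0 0; rewrite lshift0 [RHS]mxE eqxx.
rewrite -[RHS]hsubmxK; congr row_mx.
by rewrite [RHS]mx11_scalar mxE lshift0.
Qed.

(** * Quadratic exponential sums *)

Definition theta b n (A : 'M[F]_n) : algC := \sum_w chi (b * qform A w).

(** The form [A] is constant along its radical, which contributes the factor
    [q ^+ (n - \rank A)] to [theta b A]; dividing by it leaves the sum over the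
    quotient by the radical. *)
Definition norm_theta b n (A : 'M[F]_n) : algC :=
  q ^+ \rank A / q ^+ n * theta b A.

Lemma theta_congr b n (P A : 'M[F]_n) : P \in unitmx ->
  theta b (P *m A *m P^T) = theta b A.
Proof.
move=> uP; rewrite /theta [RHS](reindex_inj (can_inj (mulmxK uP))) /=.
by apply: eq_bigr => w _; rewrite qform_congr.
Qed.

Lemma qform_bord n x (u : 'rV[F]_n) A z w :
  qform (bord x u A) (row_mx z%:M w) =
  x * z ^+ 2 + 2%:R * z * (u *m w^T) 0 0 + qform A w.
Proof.
rewrite /qform /bord mul_row_block tr_row_mx mul_row_col tr_scalar_mx.
rewrite mul_mx_scalar !mul_scalar_mx.
have e : (w *m u^T) 0 0 = (u *m w^T) 0 0.
  by rewrite -[in RHS](trmxK u) -trmx_mul [RHS]mxE.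
rewrite mulmxDl -scalemxAl; move: (w *m u^T) (u *m w^T) (w *m A *m w^T) e.
by move=> a1 a2 a3 e; rewrite !mxE eqxx mulr1n e; ring.
Qed.

Lemma qform_block n y (A : 'M[F]_n) z w :
  qform (block_mx y%:M 0 0 A) (row_mx z%:M w) = y * z ^+ 2 + qform A w.
Proof.
by have := qform_bord y 0 A z w; rewrite /bord trmx0 mul0mx mxE mulr0 addr0.
Qed.

Lemma theta_block b n y (A : 'M[F]_n) :
  theta b (block_mx y%:M 0 0 A : 'M_(1 + n)) = gauss (b * y) * theta b A.
Proof.
rewrite {1}/theta sum_rV_split mulr_suml; apply: eq_bigr => z _.
rewrite mulr_sumr; apply: eq_bigr => w _.
by rewrite qform_block mulrDr chiD mulrA.
Qed.

Lemma theta_bord_in b n y w (A : 'M[F]_n) : A \in symmx F n ->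
  theta b (bord (qform A w + y) (w *m A) A) = gauss (b * y) * theta b A.
Proof.
by move=> sA; rewrite bord_in_congr // theta_congr ?upper_unipotent_unitmx // theta_block.
Qed.

(** The row space of a symmetric matrix is the orthogonal of its kernel. *)
Lemma notin_rowspace_kernel n (u : 'rV[F]_n) (A : 'M[F]_n) : A \in symmx F n ->
  ~~ (u <= A)%MS -> exists2 k : 'rV[F]_n, k *m A = 0 & (u *m k^T) 0 0 != 0.
Proof.
rewrite mem_symmx submxE => /eqP sA /rV0Pn[j nz].
exists (col j (cokermx A))^T; last by rewrite trmxK colE mulmxA -colE mxE.
by rewrite -{2}sA -trmx_mul colE mulmxA mulmx_coker mul0mx trmx0.
Qed.

Lemma qformD_ker n (A : 'M[F]_n) w k : A \in symmx F n -> k *m A = 0 ->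
  qform A (w + k) = qform A w.
Proof.
rewrite mem_symmx => /eqP sA kA.
rewrite /qform mulmxDl kA addr0 linearD /= mulmxDr -(mulmxA w A k^T).
by rewrite -[A *m k^T]trmxK trmx_mul trmxK sA kA trmx0 mulmx0 addr0.
Qed.

(** Sum over vectors [(z, w)].  For [z != 0], translating [w] along a kernel
    vector of [A] that is not orthogonal to [u] multiplies the inner sum by a
    nontrivial value of [chi], so it vanishes; only [z = 0] contributes. *)
Lemma theta_bord_notin b n x u (A : 'M[F]_n) : b != 0 -> A \in symmx F n ->
  ~~ (u <= A)%MS -> theta b (bord x u A) = theta b A.
Proof.
move=> nzb sA uA; rewrite {1}/theta sum_rV_split (bigD1 0) //=.
rewrite [X in _ + X]big1 ?addr0 => [|z nzz].
  by apply: eq_bigr => w _; rewrite qform_bord expr0n !mulr0 mul0r !add0r.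
have [k kA uk] := notin_rowspace_kernel sA uA; have [y ny] := chi_nt.
(* The scalar is chosen so that translation by [k'] multiplies by [chi y]. *)
pose k' := (y / (b * 2%:R * z * (u *m k^T) 0 0)) *: k.
have k'A : k' *m A = 0 by rewrite -scalemxAl kA scaler0.
set s := \sum_w _; have e : s = chi y * s.
  rewrite {1}/s (reindex_inj (addIr k')) /= mulr_sumr; apply: eq_bigr => w _.
  rewrite -chiD; congr chi; rewrite !qform_bord qformD_ker // linearD /= mulmxDr.
  rewrite [k'^T]linearZ /= -scalemxAr; move: (u *m w^T) (u *m k^T) uk => p r uk'.
  by rewrite !mxE; field; rewrite ?nzb ?nzz ?uk' ?two_neq0.
apply/eqP; move/eqP: e; rewrite -subr_eq0 -{1}(mul1r s) -mulrBl mulf_eq0.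
by rewrite subr_eq0 eq_sym (negPf ny).
Qed.

Lemma norm_theta_bord_in b n y w (A : 'M[F]_n) : A \in symmx F n ->
  norm_theta b (bord (qform A w + y) (w *m A) A) =
  (if y == 0 then 1 else gauss (b * y)) * norm_theta b A.
Proof.
move=> sA; rewrite /norm_theta rank_bord_in // theta_bord_in //.
have [-> | nzy] /= := eqVneq y 0.
  by rewrite mulr0 gauss0 exprS; field; rewrite expf_neq0 // q_neq0.
by rewrite !exprS; field; rewrite expf_neq0 // q_neq0.
Qed.

Lemma norm_theta_bord_notin b n x u (A : 'M[F]_n) : b != 0 -> A \in symmx F n ->
  ~~ (u <= A)%MS -> norm_theta b (bord x u A) = q * norm_theta b A.
Proof.
move=> nzb sA uA; rewrite /norm_theta rank_bord_notin // theta_bord_notin //.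
by rewrite !exprS; field; rewrite expf_neq0 // q_neq0.
Qed.

Lemma plane_sign_scale b c y : y != 0 -> plane_sign (b * y) (c * y) = plane_sign b c.
Proof.
move=> nzy; rewrite /plane_sign; congr (if _ then _ else _).
apply: eq_existsb => z.
by rewrite -mulNr mulrAC (inj_eq (mulIf nzy)).
Qed.

Lemma plane_sign_sqr b c : plane_sign b c ^+ 2 = 1.
Proof. by rewrite /plane_sign; case: ifP; rewrite ?sqrrN expr1n. Qed.

(** By induction on the size: bordering inside the row space multiplies both
    sides by 1 or by [gauss (b * y) * gauss (c * y) = plane_sign b c * q], and
    bordering outside it multiplies them by [q ^+ 2]. *)
Lemma norm_theta_mul b c n (A : 'M[F]_n) : b != 0 -> c != 0 -> A \in symmx F n ->
  norm_theta b A * norm_theta c A = (plane_sign b c * q) ^+ \rank A.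
Proof.
move=> nzb nzc; elim: n A => [|n IHn] A.
  move=> _; rewrite (flatmx0 A) mxrank0 /norm_theta mxrank0 !expr0 divr1 !mul1r.
  rewrite /theta !(big_pred1 0) => [|w|w]; rewrite ?(thinmx0 w) /= ?eqxx //.
  by rewrite /qform !mul0mx mxE !mulr0 chi0 mulr1.
move=> sB; rewrite (symmx_bordE sB).
have := sB; rewrite {1}(symmx_bordE sB) bord_symmx.
move: (A 0 0) (ursubmx _) (drsubmx _) => x u A' sA.
have [/submxP[w ->] | uA] := boolP (u <= A')%MS; last first.
  rewrite !norm_theta_bord_notin // rank_bord_notin // mulrACA IHn // !exprS.
  by rewrite mulrA; congr (_ * _); rewrite -!expr2 exprMn plane_sign_sqr mul1r.
have [y ->] : exists y, x = qform A' w + y by exists (x - qform A' w); rewrite addrC subrK.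
rewrite !norm_theta_bord_in // rank_bord_in // mulrACA IHn //.
have [_ | nzy] /= := eqVneq y 0; first by rewrite !mul1r.
by rewrite gauss_mul ?mulf_neq0 // plane_sign_scale // exprS.
Qed.

(** * Peeling off rows and columns *)

(** The rank condition is void if [r < a] and impossible if [r > a]; if
    [r = a] it forces [y = 0]. *)
Lemma sum_chi_rank a r b : b != 0 ->
  \sum_y (((y != 0%R) + r <= a)%N)%:R * chi (b * y) = (r == a)%:R.
Proof.
move=> nzb; case: (ltngtP r a) => [lt | gt | ->].
- rewrite -[RHS](mul0r q) -[0 in RHS]/((false)%:R) -(negPf nzb) -sum_chi.
  apply: eq_bigr => y _; suff -> : ((y != 0%R) + r <= a)%N by rewrite mul1r.
  by case: (y != 0); rewrite // ltnW.
- apply: big1 => y _; suff /negPf-> : ~~ ((y != 0%R) + r <= a)%N by rewrite mul0r.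
  by rewrite -ltnNge (leq_trans gt) // leq_addl.
rewrite (bigD1 0) //= eqxx leqnn mulr0 chi0 mulr1 big1 ?addr0 // => y ->.
by rewrite ltnn mul0r.
Qed.

Definition char_sum n a (B : 'M[F]_n) : algC :=
  \sum_(A in symmx_le F n a) chi (\tr (B *m A)).

Definition twisted_sum b n a (B : 'M[F]_n) : algC :=
  \sum_(A in symmx F n | \rank A == a) chi (\tr (B *m A)) * norm_theta b A.

(** For [a = 0] the two rank conditions coincide. *)
Definition pair_sum n a (B : 'M[F]_n) : algC :=
  \sum_(A in symmx F n | (\rank A == a) || (\rank A == a.-1)) chi (\tr (B *m A)).

Lemma tr_block_bord n b x u (B A : 'M[F]_n) :
  \tr ((block_mx b%:M 0 0 B : 'M_(1 + n)) *m bord x u A) = b * x + \tr (B *m A).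
Proof.
rewrite mulmx_block !mul0mx !addr0 !add0r mxtrace_block.
by rewrite -scalar_mxM mxtrace_scalar mulr1n.
Qed.

(** Borders outside the row space of [A] contribute 0 because the corner is
    then free; those inside it leave only the [A] of rank exactly [a], each
    with the weight [norm_theta b A]. *)
Lemma char_sum_block n a b (B : 'M[F]_n) : b != 0 ->
  char_sum a (block_mx b%:M 0 0 B : 'M_(1 + n)) = twisted_sum b a B.
Proof.
move=> nzb; rewrite /char_sum /twisted_sum.
rewrite (eq_bigl (fun A => (A \in symmx F n.+1) && (\rank A <= a)%N)); last first.
  by move=> A; rewrite inE.
rewrite big_mkcondr [RHS]big_mkcondr /= sum_symmx_bord; apply: eq_bigr => A sA.
transitivity (chi (\tr (B *m A)) *
    \sum_u \sum_x (\rank (bord x u A) <= a)%N%:R * chi (b * x)).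
  rewrite mulr_sumr; apply: eq_bigr => u _; rewrite mulr_sumr; apply: eq_bigr => x _.
  rewrite tr_block_bord chiD; case: ifP => _; last by rewrite mul0r mulr0.
  by rewrite mul1r mulrC.
suff -> : \sum_u \sum_x (\rank (bord x u A) <= a)%N%:R * chi (b * x) =
    (\rank A == a)%:R * norm_theta b A.
  by case: ifP => _; rewrite ?mul1r // mul0r mulr0.
rewrite (sum_rowspace_split A) big1 ?add0r => [|u uA].
  rewrite mulrCA; congr (_ * _); rewrite mulr_sumr; apply: eq_bigr => w _.
  rewrite -(sum_chi_rank a (\rank A) nzb) mulr_suml; apply: eq_bigr => y _.
  by rewrite rank_bord_in // mulrDr chiD -mulrA; congr (_ * _); rewrite mulrC.
rewrite (eq_bigr (fun x => ((\rank A).+2 <= a)%N%:R * chi (b * x))) => [|x _].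
  by rewrite -mulr_sumr sum_chi (negPf nzb) mul0r mulr0.
by rewrite rank_bord_notin.
Qed.

(** Summing first over [y] counts the solutions [z] of [b * z ^+ 2 = - c]; the
    term [- q] removes [y = 0]. *)
Lemma sum_chi_gauss b c :
  \sum_(y | y != 0) chi (c * y) * gauss (b * y) =
  (#|sqr_fiber b (- c)|%:R - 1) * q.
Proof.
have e : \sum_y chi (c * y) * gauss (b * y) = #|sqr_fiber b (- c)|%:R * q.
  transitivity (\sum_z \sum_y chi ((b * z ^+ 2 + c) * y)).
    rewrite exchange_big; apply: eq_bigr => y _; rewrite mulr_sumr.
    by apply: eq_bigr => z _; rewrite -chiD; congr chi; ring.
  rewrite (eq_bigr (fun z => (z \in sqr_fiber b (- c))%:R * q)) => [|z _].
    rewrite -mulr_suml -natr_sum; congr (_%:R * _).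
    by rewrite -sum1_card [RHS]big_mkcond; apply: eq_bigr => z _; case: ifP.
  by rewrite sum_chi addr_eq0.
move/eqP: e; rewrite (bigD1 0) //= !mulr0 chi0 mul1r gauss0 -subr_eq0 => /eqP e.
by apply/eqP; rewrite -subr_eq0; apply/eqP; rewrite -[RHS]e; ring.
Qed.

Lemma sum_chi_gauss_rank a r b c :
  \sum_y ((y != 0%R) + r == a)%N%:R *
    (chi (c * y) * (if y == 0 then 1 else gauss (b * y))) =
  (r == a)%:R + (r.+1 == a)%:R * ((#|sqr_fiber b (- c)|%:R - 1) * q).
Proof.
rewrite (bigD1 0) //= eqxx mulr0 chi0 !mulr1; congr (_ + _).
rewrite -sum_chi_gauss mulr_sumr; apply: eq_bigr => y nzy.
by rewrite nzy (negPf nzy).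
Qed.

Lemma sum_notin_rowspace n (A : 'M[F]_n) (x : algC) :
  \sum_(u : 'rV[F]_n | ~~ (u <= A)%MS) x = (q ^+ n - q ^+ \rank A) * x.
Proof.
have eA : \sum_(u : 'rV[F]_n | (u <= A)%MS) x = q ^+ \rank A * x.
  by rewrite sumr_const card_rowspace -natrX mulr_natl.
have eT : \sum_(u : 'rV[F]_n) x = q ^+ n * x.
  by rewrite sumr_const card_mx mul1n -natrX mulr_natl.
rewrite mulrBl -eA -eT [in RHS](bigID (fun u : 'rV[F]_n => (u <= A)%MS)) /=.
by rewrite addrAC subrr add0r.
Qed.

(** Two kinds of [A] survive the summation over the border: those of rank [a],
    with [y = 0], and those of rank [a - 1], with [y != 0], for which the sum
    over [y] gives the missing factor [plane_sign b c * q]. *)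
Lemma twisted_sum_block n a b c (B : 'M[F]_n) : b != 0 -> c != 0 ->
  twisted_sum b a (block_mx c%:M 0 0 B : 'M_(1 + n)) =
  (plane_sign b c * q) ^+ a * pair_sum a B.
Proof.
move=> nzb nzc; rewrite /twisted_sum /pair_sum mulr_sumr.
rewrite big_mkcondr [RHS]big_mkcondr /= sum_symmx_bord; apply: eq_bigr => A sA.
transitivity (chi (\tr (B *m A)) * \sum_u \sum_x
    (\rank (bord x u A) == a)%:R * (chi (c * x) * norm_theta b (bord x u A))).
  rewrite mulr_sumr; apply: eq_bigr => u _; rewrite mulr_sumr; apply: eq_bigr => x _.
  rewrite tr_block_bord chiD; case: ifP => _; last by rewrite mul0r mulr0.
  by rewrite mul1r; ring.
rewrite (sum_rowspace_split A) big1 ?add0r => [|u uA]; last first.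
  rewrite (eq_bigr (fun x => (((\rank A).+2 == a)%:R * (q * norm_theta b A)) *
      chi (c * x))) => [|x _].
    by rewrite -mulr_sumr sum_chi (negPf nzc) mul0r mulr0.
  by rewrite rank_bord_notin // norm_theta_bord_notin //; ring.
rewrite (eq_bigr (fun w => chi (c * qform A w) * (norm_theta b A *
   ((\rank A == a)%:R + ((\rank A).+1 == a)%:R * (plane_sign b c * q))))) => [|w _].
  rewrite -mulr_suml -/(theta c A) [LHS](_ : _ = chi (\tr (B *m A)) *
    (norm_theta b A * norm_theta c A * ((\rank A == a)%:R +
      ((\rank A).+1 == a)%:R * (plane_sign b c * q)))); last by rewrite [norm_theta c A]/norm_theta; ring.
  rewrite norm_theta_mul //; move: (plane_sign b c * q) => s.
  case: a => [|a]; first by rewrite mul0r addr0 orbb; case: eqP => [->|_];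
    rewrite !(mulr0, mulr1, mul1r).
  rewrite eqSS /=; have [->|_] := eqVneq (\rank A) a.+1.
    by rewrite (_ : (a.+1 == a) = false) 1?mul0r ?addr0 ?mulr1 1?mulrC //; lia.
  have [->|_] /= := eqVneq (\rank A) a; first by rewrite add0r mul1r -exprSr mulrC.
  by rewrite mul0r addr0 !mulr0.
have -> : plane_sign b c = #|sqr_fiber b (- c)|%:R - 1.
  by rewrite card_isotropic // addrC addKr.
rewrite -sum_chi_gauss_rank !mulr_sumr; apply: eq_bigr => y _.
rewrite rank_bord_in // norm_theta_bord_in // mulrDr chiD.
by move: (_ == a)%:R (if _ then _ else _) => e g; ring.
Qed.

(** No character of the corner occurs in this sum, so borders outside the
    row space do contribute, from rank [a - 2]; rank [a - 1] does not, since
    the sum of [gauss (b * y)] over [y != 0] is 0. *)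
Lemma twisted_sum_rec n a b : b != 0 ->
  twisted_sum b a (0 : 'M_(1 + n)) = q ^+ a * twisted_sum b a (0 : 'M_n) +
  (if a is k.+2 then (q ^+ n.+2 - q ^+ a) * twisted_sum b k (0 : 'M_n) else 0).
Proof.
move=> nzb.
have tw0 m k : twisted_sum b k (0 : 'M_m) =
    \sum_(A in symmx F m) (\rank A == k)%:R * norm_theta b A.
  rewrite /twisted_sum big_mkcondr; apply: eq_bigr => A _.
  by rewrite mul0mx mxtrace0 chi0 mul1r; case: ifP; rewrite ?mul1r ?mul0r.
rewrite !tw0 sum_symmx_bord.
transitivity (\sum_(A in symmx F n) (q ^+ a * ((\rank A == a)%:R * norm_theta b A) +
  (q ^+ n.+2 - q ^+ a) * (((\rank A).+2 == a)%:R * norm_theta b A))); last first.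
  rewrite big_split /= -!mulr_sumr; congr (_ + _).
  case: a => [|[|a]]; rewrite ?tw0 //; rewrite big1 ?mulr0 // => A _;
    by rewrite mul0r.
apply: eq_bigr => A sA; rewrite (sum_rowspace_split A) addrC; congr (_ + _).
  transitivity (q ^+ \rank A / q ^+ n * \sum_(w : 'rV[F]_n)
     (\rank A == a)%:R * norm_theta b A).
    congr (_ * _); apply: eq_bigr => w _.
    transitivity (norm_theta b A * \sum_y ((y != 0%R) + \rank A == a)%N%:R *
      (chi (0 * y) * (if y == 0 then 1 else gauss (b * y)))).
      rewrite mulr_sumr; apply: eq_bigr => y _.
      rewrite rank_bord_in // norm_theta_bord_in // mul0r chi0.
      by move: (_ == a)%:R (if _ then _ else _) => e g; ring.
    rewrite sum_chi_gauss_rank (eq_card (B := pred1 0)) ?card1 => [|z].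
      by rewrite subrr mul0r mulr0 addr0 mulrC.
    by rewrite !inE oppr0 mulf_eq0 (negPf nzb) expf_eq0.
  rewrite sumr_const card_mx mul1n -[_ *+ (_ ^ _)]mulr_natl natrX mulrA mulfVK ?expf_neq0 //.
  by case: eqP => [->|_]; rewrite // !mul0r !mulr0.
rewrite (eq_bigr (fun=> q * (((\rank A).+2 == a)%:R * (q * norm_theta b A)))) => [|u uA].
  rewrite sum_notin_rowspace; case: eqP => [<-|_]; last by rewrite !mul0r !mulr0.
  by rewrite !mul1r !exprS; ring.
rewrite (eq_bigr (fun=> ((\rank A).+2 == a)%:R * (q * norm_theta b A))) => [|x _].
  by rewrite sumr_const [RHS]mulr_natl.
by rewrite rank_bord_notin // norm_theta_bord_notin.
Qed.

Lemma sum_const_neq0 (x : algC) : \sum_(y : F | y != 0) x = (q - 1) * x.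
Proof.
have : \sum_(y : F) x = q * x by rewrite sumr_const mulr_natl.
by rewrite (bigD1 0) //= mulrBl mul1r => <-; rewrite addrAC subrr add0r.
Qed.

Lemma pair_sum_rec n a :
  pair_sum a (0 : 'M_(1 + n)) = q ^+ a * pair_sum a (0 : 'M_n) +
  (if a is k.+2 then (q ^+ n.+1 - q ^+ k) * pair_sum k (0 : 'M_n) else 0).
Proof.
pose P k r : algC := ((r == k) || (r == k.-1))%:R.
have ps0 m k : pair_sum k (0 : 'M_m) = \sum_(A in symmx F m) P k (\rank A).
  rewrite /pair_sum big_mkcondr; apply: eq_bigr => A _.
  by rewrite mul0mx mxtrace0 chi0 /P; case: ifP.
rewrite !ps0 sum_symmx_bord.
transitivity (\sum_(A in symmx F n) (q ^+ a * P a (\rank A) +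
  if a is k.+2 then (q ^+ n.+1 - q ^+ k) * P k (\rank A) else 0)); last first.
  rewrite big_split /= -!mulr_sumr; congr (_ + _).
  by case: a => [|[|a]]; rewrite ?ps0 ?mulr_sumr // big1.
apply: eq_bigr => A sA; rewrite (sum_rowspace_split A); set r := \rank A.
transitivity ((q ^+ n - q ^+ r) * (q * P a r.+2) +
  q ^+ r * (P a r + (q - 1) * P a r.+1)).
  congr (_ + _).
    rewrite -sum_notin_rowspace; apply: eq_bigr => u uA.
    rewrite (eq_bigr (fun=> P a r.+2)) ?sumr_const ?mulr_natl // => x _.
    by rewrite rank_bord_notin.
  transitivity (q ^+ r / q ^+ n * \sum_(w : 'rV[F]_n) (P a r + (q - 1) * P a r.+1)).
    congr (_ * _); apply: eq_bigr => w _.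
    rewrite (eq_bigr (fun y => P a ((y != 0%R) + r)%N)) => [|y _]; last first.
      by rewrite rank_bord_in.
    rewrite (bigD1 0) //= eqxx; congr (_ + _).
    rewrite (eq_bigr (fun=> P a r.+1)) => [|y ->] //.
    exact: sum_const_neq0.
  by rewrite sumr_const card_mx mul1n -[_ *+ (_ ^ _)]mulr_natl natrX mulrA mulfVK ?expf_neq0.
rewrite /P; case: a => [|[|a]] /=.
- by rewrite !orbb; case: r => [|r] /=; rewrite ?expr0; ring.
- by case: r => [|[|r]] /=; rewrite ?expr0 ?expr1; ring.
rewrite !eqSS; have [->|n2] := eqVneq r a.+2.
  have -> : (a.+2 == a) = false by lia.
  have -> : (a.+3 == a) = false by lia.
  have -> : (a.+2 == a.-1) = false by lia.
  have -> : (a.+2 == a.+1) = false by lia.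
  by rewrite /=; ring.
have [->|n1] := eqVneq r a.+1.
  have -> : (a.+1 == a) = false by lia.
  have -> : (a.+2 == a) = false by lia.
  have -> : (a.+1 == a.-1) = false by lia.
  by rewrite /= !exprS; ring.
have [->|n0] /= := eqVneq r a; first by rewrite !exprS; ring.
have [<-|nm] := eqVneq r.+1 a; first by rewrite /= eqxx mulr1n !exprS; ring.
have [ra|_] := eqVneq r a.-1; last by rewrite mulr0n; ring.
by exfalso; move: n0 nm; rewrite ra; lia.
Qed.

(** * Values at the zero matrix *)

Lemma symmx0 n : (0 : 'M[F]_n) \in symmx F n.
Proof. by rewrite mem_symmx trmx0. Qed.

Lemma big_symmx_dim0 (P : pred 'M[F]_0) (f : 'M[F]_0 -> algC) :
  \sum_(A in symmx F 0 | P A) f A = (P 0)%:R * f 0.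
Proof.
rewrite big_mkcondr (big_pred1 0) => [|A]; last by rewrite (flatmx0 A) symmx0 /= eqxx.
by case: ifP => _; rewrite ?mul1r ?mul0r.
Qed.

Lemma twisted_sum_dim0 b a : twisted_sum b a (0 : 'M_0) = (0 == a)%:R.
Proof.
rewrite /twisted_sum big_symmx_dim0 mxrank0 mul0mx mxtrace0 chi0 mul1r.
rewrite /norm_theta mxrank0 !expr0 divr1 mul1r /theta (big_pred1 0) => [|w]; last first.
  by rewrite (thinmx0 w) /= eqxx.
by rewrite /qform !mul0mx mxE mulr0 chi0 mulr1.
Qed.

Lemma pair_sum_dim0 a : pair_sum a (0 : 'M_0) = ((0 == a) || (0 == a.-1))%:R.
Proof. by rewrite /pair_sum big_symmx_dim0 mxrank0 mul0mx mxtrace0 chi0 mulr1. Qed.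

(** Both sides satisfy the same recursion, [twisted_sum_rec] at size [n + 1]
    and [pair_sum_rec] at size [n]. *)
Lemma twisted_sum_even b n t : b != 0 ->
  twisted_sum b t.*2 (0 : 'M_(1 + n)) = q ^+ t.*2 * pair_sum t.*2 (0 : 'M_n).
Proof.
move=> nzb; elim: n t => [|n IHn] t.
  rewrite twisted_sum_rec // twisted_sum_dim0 pair_sum_dim0.
  case: t => [|[|t]]; rewrite ?doubleS /= ?twisted_sum_dim0 /=; first by rewrite addr0.
    by rewrite subrr mul0r !mulr0 addr0.
  by rewrite !mulr0 addr0.
rewrite twisted_sum_rec // pair_sum_rec IHn.
case: t => [|t]; first by rewrite !addr0 mulrA.
by rewrite doubleS /= (IHn t) !exprS; ring.
Qed.

Lemma twisted_sum_odd b n t : b != 0 ->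
  twisted_sum b t.*2.+1 (0 : 'M_n) = 0.
Proof.
move=> nzb; elim: n t => [|n IHn] t; first by rewrite twisted_sum_dim0.
rewrite (@twisted_sum_rec n) // IHn mulr0 add0r.
by case: t => [|t] //; rewrite doubleS /= IHn mulr0.
Qed.

Lemma pair_sum_bound n a (B : 'M[F]_n) :
  `|pair_sum a B| <= pair_sum a (0 : 'M_n).
Proof.
apply: le_trans (ler_norm_sum _ _ _) _; rewrite /pair_sum.
by apply: ler_sum => A _; rewrite chi_norm mul0mx mxtrace0 chi0.
Qed.

(** * Congruence and diagonalisation *)

Lemma congr_invK n (P B : 'M[F]_n) : P \in unitmx ->
  invmx P *m (P *m B *m P^T) *m (invmx P)^T = B.
Proof.
move=> uP; rewrite !mulmxA mulVmx // mul1mx -mulmxA -trmx_mul mulVmx //.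
by rewrite trmx1 mulmx1.
Qed.

Lemma symmx_congrE n (P A : 'M[F]_n) : P \in unitmx ->
  (P *m A *m P^T \in symmx F n) = (A \in symmx F n).
Proof.
move=> uP; apply/idP/idP => [/(symmx_congr (invmx P))|]; last exact: symmx_congr.
by rewrite congr_invK.
Qed.

Lemma char_sum_congr n a (P B : 'M[F]_n) : P \in unitmx ->
  char_sum a (P *m B *m P^T) = char_sum a B.
Proof.
move=> uP; rewrite /char_sum.
have inj : injective (fun A => P^T *m A *m P^T^T).
  by apply: (can_inj (g := fun A => invmx P^T *m A *m (invmx P^T)^T)) => A;
    rewrite congr_invK ?unitmx_tr.
rewrite [RHS](reindex_inj inj) /=; apply: eq_big => [A | A _].
  by rewrite !mem_symmx_le symmx_congrE ?rank_congr ?unitmx_tr.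
by rewrite trmxK -2!mulmxA mxtrace_mulC !mulmxA.
Qed.

Lemma delta_mulmx_delta n (B : 'M[F]_n) i j :
  ((delta_mx 0 i : 'rV_n) *m B *m (delta_mx 0 j : 'rV_n)^T) 0 0 = B i j.
Proof. by rewrite -rowE trmx_delta -colE !mxE. Qed.

(** Polarisation, available since 2 is invertible. *)
Lemma qform_neq0 n (B : 'M[F]_n) : B \in symmx F n -> B != 0 ->
  exists v, qform B v != 0.
Proof.
rewrite mem_symmx => /eqP sB nzB; apply/existsP; apply: contraR nzB.
rewrite negb_exists => /forallP h.
have Q0 v : qform B v = 0 by apply/eqP; have := h v; rewrite negbK.
apply/eqP/matrixP => i j; rewrite mxE.
have := Q0 (delta_mx 0 i + delta_mx 0 j).
rewrite /qform linearD /= mulmxDl mulmxDr !mulmxDl.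
rewrite mxE [X in X + _]mxE [X in _ + X]mxE !delta_mulmx_delta.
have := Q0 (delta_mx 0 i); have := Q0 (delta_mx 0 j); rewrite /qform !delta_mulmx_delta => -> ->.
have -> : B j i = B i j by rewrite -[in LHS]sB mxE.
rewrite add0r addr0 -mulr2n -mulr_natl => e2; apply/eqP; move/eqP: e2.
by rewrite mulf_eq0 (negPf two_neq0).
Qed.

(** A Gaussian elimination of the single row [v] exhibits it as a multiple of
    the first row of an invertible matrix. *)
Lemma unit_row_extension n (v : 'rV[F]_(1 + n)) : v != 0 ->
  exists2 P : 'M[F]_(1 + n), P \in unitmx & exists l, v = l *: row 0 P.
Proof.
move=> nzv; exists (row_ebase v); first exact: row_ebase_unit.
exists (col_ebase v 0 0); rewrite -[LHS]mulmx_ebase -mulmxA -mul_scalar_mx.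
rewrite -mx11_scalar; congr (_ *m _); rewrite rowE; congr (_ *m _).
by apply/rowP=> i; rewrite !mxE rank_rV nzv [i == 0]eq_sym; case: i => [[|i] ?].
Qed.

(** A vector on which the form does not vanish is put in first position, and
    the rest of its row and column is then cleared by a congruence. *)
Lemma symmx_split n (B : 'M[F]_(1 + n)) : B \in symmx F n.+1 -> B != 0 ->
  exists P, exists b, exists B0 : 'M[F]_n,
    [/\ P \in unitmx, b != 0, B0 \in symmx F n
      & B = P *m block_mx b%:M 0 0 B0 *m P^T].
Proof.
move=> sB nzB; have [v nzQ] := qform_neq0 sB nzB.
have nzv : v != 0.
  by apply: contraNneq nzQ => ->; rewrite /qform !mul0mx mxE.
have [R uR [l vE]] := unit_row_extension nzv.
set B' := R *m B *m R^T.
have sB' : B' \in symmx F n.+1 by rewrite symmx_congr.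
have b0 : B' 0 0 != 0.
  apply: contraNneq nzQ => e; rewrite vE rowE scalemxAl -qform_congr -/B'.
  rewrite /qform linearZ /= -scalemxAr -!scalemxAl mxE [X in _ * X]mxE.
  by rewrite delta_mulmx_delta e !mulr0.
have E := symmx_bordE sB'.
move: (B' 0 0) (ursubmx B') (drsubmx B') b0 E sB' => b u A b0 E.
rewrite E bord_symmx => sA.
pose L : 'M_(1 + n) := block_mx 1%:M 0 (b^-1 *: u^T) 1%:M.
exists (invmx R *m L), b, (A - b^-1 *: (u^T *m u)); split=> //.
- by rewrite unitmx_mul unitmx_inv uR unitmxE det_lblock !det1 mulr1 unitr1.
- move: sA; rewrite !mem_symmx => /eqP sA.
  by rewrite linearB /= linearZ /= trmx_mul trmxK sA.
rewrite -[LHS](congr_invK B uR) -/B' E trmx_mul !mulmxA.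
rewrite -(mulmxA _ L) -(mulmxA _ (L *m _)); congr (_ *m _ *m _).
rewrite /L (tr_block_mx (m1 := 1) (n1 := 1)) !mulmx_block.
rewrite !trmx1 !trmx0 !(mul1mx, mulmx1, mul0mx, mulmx0, addr0, add0r).
rewrite linearZ /= trmxK -!scalemxAl !mul_mx_scalar scalerA mulVf // scale1r.
rewrite mul_scalar_mx scalerA mulfV // scale1r -scalemxAr.
rewrite /bord; congr block_mx.
by rewrite -scalemxAl !scalerA mulVf // mulr1 addrC subrK.
Qed.

Lemma rank_block n b (C : 'M[F]_n) : b != 0 ->
  \rank (block_mx b%:M 0 0 C : 'M_(1 + n)) = (\rank C).+1.
Proof.
by move=> nzb; rewrite rank_diag_block_mx -scalemx1 mxrank_scale_nz ?mxrank1.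
Qed.

Lemma symmx_split2 n (B : 'M[F]_(1 + (1 + n))) :
  B \in symmx F n.+2 -> (1 < \rank B)%N ->
  exists P, exists b, exists c, exists B1 : 'M[F]_n,
    [/\ P \in unitmx, b != 0, c != 0, \rank B = (\rank B1).+2
      & B = P *m block_mx b%:M 0 0 (block_mx c%:M 0 0 B1 : 'M_(1 + n)) *m P^T].
Proof.
move=> sB rB.
have nzB : B != 0 by apply: contraTneq rB => ->; rewrite mxrank0.
have [P [b [B0 [uP nzb sB0 E]]]] := symmx_split sB nzB.
have nzB0 : B0 != 0.
  by apply: contraTneq rB => e; rewrite E rank_congr // rank_block // e mxrank0.
have [P0 [c [B1 [uP0 nzc _ E0]]]] := symmx_split sB0 nzB0.
exists (P *m block_mx 1%:M 0 0 P0), b, c, B1; split=> //.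
- by rewrite unitmx_mul uP unitmxE det_ublock det1 mul1r -unitmxE.
- by rewrite E rank_congr // rank_block // E0 rank_congr // rank_block.
rewrite E trmx_mul !mulmxA; congr (_ *m _); rewrite -!mulmxA; congr (_ *m _).
rewrite (tr_block_mx (m1 := 1) (n1 := 1)) !mulmx_block.
rewrite !trmx1 !trmx0 !(mul1mx, mulmx1, mul0mx, mulmx0, addr0, add0r).
by rewrite E0 !mulmxA.
Qed.

(** * The character sum by rank and type *)

(** The common value at the nonzero [B] of smallest weight; the size of [B] is
    [n + 2]. *)
Definition char_sum_max n a : algC := q ^+ a * pair_sum a (0 : 'M_n).

Lemma char_sum_diag2 n a b c (P : 'M[F]_(1 + (1 + n))) B1 :
  P \in unitmx -> b != 0 -> c != 0 ->
  char_sum a (P *m block_mx b%:M 0 0 (block_mx c%:M 0 0 B1 : 'M_(1 + n)) *m P^T) =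
  (plane_sign b c * q) ^+ a * pair_sum a B1.
Proof.
by move=> uP nzb nzc; rewrite char_sum_congr // char_sum_block // twisted_sum_block.
Qed.

Lemma char_sum_max_ge0 n a : 0 <= char_sum_max n a.
Proof.
rewrite mulr_ge0 ?exprn_ge0 ?ler0n //.
by rewrite (le_trans _ (pair_sum_bound a (0 : 'M_n))).
Qed.

Lemma char_sum_rank1 n a (B : 'M[F]_(1 + (1 + n))) : B \in symmx F n.+2 ->
  \rank B = 1%N -> char_sum a B = if odd a then 0 else char_sum_max n a.
Proof.
move=> sB rB.
have nzB : B != 0 by rewrite -mxrank_eq0 rB.
have [P [b [B0 [uP nzb _ E]]]] := symmx_split sB nzB.
have B00 : B0 = 0.
  move: rB; rewrite E rank_congr // rank_diag_block_mx -scalemx1 mxrank_scale_nz //.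
  by rewrite mxrank1 add1n => -[/eqP]; rewrite mxrank_eq0 => /eqP.
rewrite E B00 char_sum_congr // char_sum_block // -{1}(odd_double_half a).
case: (boolP (odd a)) => oa; first by rewrite add1n twisted_sum_odd.
by rewrite add0n twisted_sum_even // even_halfK.
Qed.

Lemma char_sum_bound n a (B : 'M[F]_(1 + (1 + n))) : B \in symmx F n.+2 ->
  (1 < \rank B)%N -> `|char_sum a B| <= char_sum_max n a.
Proof.
move=> sB rB; have [P [b [c [B1 [uP nzb nzc _ ->]]]]] := symmx_split2 sB rB.
rewrite char_sum_diag2 // normrM normrX normrM normr_nat.
have -> : `|plane_sign b c| = 1 by rewrite /plane_sign; case: ifP; rewrite ?normrN normr1.
by rewrite mul1r ler_wpM2l ?exprn_ge0 ?ler0n // pair_sum_bound.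
Qed.

Lemma char_sum_rank2_even n a (B : 'M[F]_(1 + (1 + n))) : B \in symmx F n.+2 ->
  \rank B = 2%N -> ~~ odd a -> char_sum a B = char_sum_max n a.
Proof.
move=> sB rB ea; have rB' : (1 < \rank B)%N by rewrite rB.
have [P [b [c [B1 [uP nzb nzc rE ->]]]]] := symmx_split2 sB rB'.
have /eqP: \rank B1 = 0%N by move: rE; rewrite rB => -[].
rewrite mxrank_eq0 => /eqP ->; rewrite char_sum_diag2 // /char_sum_max exprMn.
by rewrite -{1}(even_halfK ea) -mul2n exprM plane_sign_sqr expr1n mul1r.
Qed.

(** An isotropic vector outside the radical has nonzero second coordinate in
    the diagonal basis, so the ratio of its coordinates shows that the plane
    [b x^2 + c y^2] is isotropic. *)
Lemma char_sum_rank2_isotropic n a (B : 'M[F]_(1 + (1 + n))) (e : 'rV_(1 + (1 + n))) :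
  B \in symmx F n.+2 -> \rank B = 2%N -> qform B e = 0 -> e *m B != 0 ->
  char_sum a B = char_sum_max n a.
Proof.
move=> sB rB; have rB' : (1 < \rank B)%N by rewrite rB.
have [P [b [c [B1 [uP nzb nzc rE ->]]]]] := symmx_split2 sB rB'.
have /eqP: \rank B1 = 0%N by move: rE; rewrite rB => -[].
rewrite mxrank_eq0 => /eqP ->; rewrite qform_congr char_sum_diag2 // !mulmxA.
have [z [v ->]] := row_mx_scalarP (e *m P); have [t [w ->]] := row_mx_scalarP v.
rewrite !qform_block /qform mulmx0 mul0mx mxE addr0 => Q0 ker.
suff iso : isotropic_diag b c by rewrite /plane_sign iso mul1r.
have nzt : t != 0.
  apply: contraNneq ker => t0; move/eqP: Q0.
  rewrite t0 expr0n mulr0 addr0 mulf_eq0 (negPf nzb) expf_eq0 /= => /eqP ->.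
  rewrite mul_row_block mul_row_block !mulmx0 !mul_scalar_mx !scale0r !addr0.
  by rewrite !row_mx0 addr0 row_mx0 mul0mx.
apply/existsP; exists (z / t); rewrite -addr_eq0 expr_div_n; apply/eqP.
by apply: (mulIf (expf_neq0 2 nzt)); rewrite mul0r -[RHS]Q0; field.
Qed.

(** * Weights *)

Lemma hamming_weight_codeword n a (B : 'M[F]_n) :
  hamming_weight (codeword a B) =
  #|[set A in symmx_le F n a | \tr (B *m A) != 0]|.
Proof.
rewrite /hamming_weight -(card_imset _ enum_val_inj); apply: eq_card => A.
rewrite inE; apply/imsetP/idP => [[i] | ].
  by rewrite inE /codeword mxE => nz ->; rewrite enum_valP.
case/andP=> sA nz; exists (enum_rank_in sA A); last by rewrite enum_rankK_in.
by rewrite inE /codeword mxE enum_rankK_in.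
Qed.

Lemma char_sum_scale n a (B : 'M[F]_n) l : l != 0 ->
  \sum_(A in symmx_le F n a) chi (l * \tr (B *m A)) = char_sum a B.
Proof.
move=> nzl; rewrite /char_sum.
have inj : injective ( *:%R l : 'M[F]_n -> 'M[F]_n).
  by apply: (can_inj (g := *:%R l^-1)) => A; rewrite scalerA mulVf ?scale1r.
rewrite [RHS](reindex_inj inj) /=; apply: eq_big => [A | A _].
  rewrite !mem_symmx_le !mem_symmx linearZ /= (inj_eq inj).
  by rewrite mxrank_scale_nz.
by rewrite -scalemxAr mxtraceZ.
Qed.

(** Count the zeros of the codeword by orthogonality: the sum of
    [chi (l * \tr (B *m A))] over all [l] and [A] is [q] times their number;
    its terms with [l = 0] give the length and the other [l] give
    [char_sum a B] each. *)
Lemma weight_char_sum n a (B : 'M[F]_n) :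
  q * (hamming_weight (codeword a B))%:R =
  (q - 1) * (#|symmx_le F n a|%:R - char_sum a B).
Proof.
rewrite hamming_weight_codeword; set W := #|_|.
pose Z := #|[set A in symmx_le F n a | \tr (B *m A) == 0]|.
have ZW : #|symmx_le F n a|%:R = Z%:R + W%:R :> algC.
  rewrite -natrD -(cardsID [set A | \tr (B *m A) == 0] (symmx_le F n a)).
  congr (_ + _)%:R; apply: eq_card => A; rewrite !inE //.
  by rewrite andbC.
have e : \sum_l \sum_(A in symmx_le F n a) chi (l * \tr (B *m A)) = Z%:R * q.
  rewrite exchange_big /= (eq_bigr (fun A => (\tr (B *m A) == 0)%:R * q)); last first.
    by move=> A _; rewrite -sum_chi; apply: eq_bigr => l _; rewrite mulrC.
  rewrite -mulr_suml -natr_sum /Z -sum1_card; congr (_%:R * _).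
  rewrite [RHS](eq_bigl (fun A => (A \in symmx_le F n a) && (\tr (B *m A) == 0))).
    by rewrite big_mkcondr; apply: eq_bigr => A _; case: ifP.
  by move=> A; rewrite inE.
move: e; rewrite (bigD1 0) //= (eq_bigr (fun=> 1)) => [|A _]; last by rewrite mul0r chi0.
rewrite sumr_const (eq_bigr (fun=> char_sum a B)) => [|l nzl]; last first.
  exact: char_sum_scale.
rewrite sum_const_neq0 ZW => e; apply/eqP; rewrite -subr_eq0; apply/eqP.
suff : Z%:R + W%:R + (q - 1) * char_sum a B - Z%:R * q = 0 by move=> <-; ring.
by rewrite e subrr.
Qed.

Lemma char_sum_weight n a (B : 'M[F]_n) :
  char_sum a B = (#|symmx_le F n a| )%:R -
    q / (q - 1) * (hamming_weight (codeword a B))%:R.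
Proof.
have q1 : q - 1 != 0 by rewrite gt_eqF // subr_gt0 ltr1n finNzRing_gt1.
by rewrite mulrAC weight_char_sum mulrAC divff // mul1r opprB addrC subrK.
Qed.

(** The sum lies in [algC], whose order is partial; being real is what lets it
    be compared with its modulus. *)
Lemma char_sum_real n a (B : 'M[F]_n) : char_sum a B \is Num.real.
Proof.
by rewrite char_sum_weight !(rpredB, rpredM, rpredV) ?rpred_nat ?rpred1.
Qed.

Lemma weight_le n a (B B' : 'M[F]_n) : char_sum a B <= char_sum a B' ->
  (hamming_weight (codeword a B') <= hamming_weight (codeword a B))%N.
Proof.
have q1 : 0 < q / (q - 1) by rewrite divr_gt0 // subr_gt0 ltr1n finNzRing_gt1.
by rewrite !char_sum_weight lerD2l lerN2 ler_pM2l // ler_nat.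
Qed.

Lemma weight_eq n a (B B' : 'M[F]_n) : char_sum a B = char_sum a B' ->
  hamming_weight (codeword a B) = hamming_weight (codeword a B').
Proof. by move=> e; apply/eqP; rewrite eqn_leq !weight_le // e. Qed.

(** The rank one matrix [v^T *m v] has [\tr (B *m (v^T *m v)) = qform B v]. *)
Lemma codeword_neq0 n a (B : 'M[F]_n) : (0 < a)%N -> B \in symmx F n ->
  B != 0 -> codeword a B != 0.
Proof.
move=> a0 sB nzB; have [v nzQ] := qform_neq0 sB nzB.
have : (0 < hamming_weight (codeword a B))%N.
  rewrite hamming_weight_codeword; apply/card_gt0P; exists (v^T *m v).
  rewrite inE mem_symmx_le mem_symmx trmx_mul trmxK eqxx /=.
  rewrite (leq_trans (mxrankM_maxr _ _)) ?(leq_trans (rank_leq_row v)) //=.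
  by rewrite mulmxA mxtrace_mulC mulmxA trace_mx11.
apply: contraTneq => ->; rewrite -leqNgt leqn0 cards_eq0.
by apply/eqP/setP => i; rewrite !inE mxE eqxx.
Qed.

Lemma min_distance_codeword n a (B : 'M[F]_n) : (0 < a)%N ->
  B \in symmx F n -> B != 0 ->
  (forall B', B' \in symmx F n -> B' != 0 -> char_sum a B' <= char_sum a B) ->
  has_min_distance (Csymm F n a) (hamming_weight (codeword a B)).
Proof.
move=> a0 sB nzB max; split.
  by exists (codeword a B); split; rewrite ?codeword_neq0 // imset_f.
move=> _ /imsetP[B' sB' ->] nzc; apply/weight_le/max => //.
apply: contraNneq nzc => ->; apply/eqP/rowP=> i.
by rewrite /codeword !mxE mul0mx mxtrace0.
Qed.

(** The first vector [e] of a hyperbolic pair will do: were it in the radical,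
    then [qform B (e + f) = qform B f], that is [1 = 0]. *)
Lemma hyperbolic_isotropic n (B : 'M[F]_n) : B \in symmx F n -> \rank B = 2%N -> hyperbolic B ->
  exists2 e, qform B e = 0 & e *m B != 0.
Proof.
move=> sB rB; have -> : hyperbolic B = [exists e : 'rV[F]_n, exists f : 'rV[F]_n,
    (1%:M <= col_mx e f + kermx B)%MS &&
    [forall x : 'rV[F]_1, forall y : 'rV[F]_1,
      qform B (x *m e + y *m f) == \sum_i x 0 i * y 0 i]].
  by rewrite /hyperbolic rB.
case/existsP=> e /existsP[f /andP[_ /forallP h]].
have Q x y : qform B (x *: e + y *: f) = x * y.
  have /forallP/(_ y%:M)/eqP := h x%:M.
  by rewrite !mul_scalar_mx big_ord1 !mxE eqxx !mulr1n.
exists e; first by have := Q 1 0; rewrite scale1r scale0r addr0 mulr0.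
apply/eqP => eB; have := Q 1 1; have := Q 0 1.
rewrite scale0r add0r mul0r mulr1 !scale1r addrC qformD_ker // => ->.
by move/esym/eqP; rewrite oner_eq0.
Qed.

(** * Matrices of rank 1 and hyperbolic matrices of rank 2 *)

Lemma symmx_rank1_exists n : exists B : 'M[F]_(1 + n), B \in symmx_rank F n.+1 1.
Proof.
pose B : 'M[F]_(1 + n) := block_mx 1%:M 0 0 0.
have rB : \rank B = 1%N by rewrite rank_block ?oner_eq0 // mxrank0.
exists B; rewrite inE rB mem_symmx (tr_block_mx (m1 := 1) (n1 := 1)).
by rewrite trmx1 !trmx0 !eqxx.
Qed.

(** The form is [x^2 - y^2], with hyperbolic pair [(1, 1)],
    [(1 / 4, - 1 / 4)]. *)
Lemma symmx_hyperbolic_exists n :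
  exists B : 'M[F]_(1 + (1 + n)), B \in symmx_rank_type F n.+2 2 1.
Proof.
pose B0 : 'M[F]_(1 + n) := block_mx (-1)%:M 0 0 0.
pose B : 'M[F]_(1 + (1 + n)) := block_mx 1%:M 0 0 B0.
have rB : \rank B = 2%N.
  by rewrite !rank_block ?oppr_eq0 ?oner_eq0 // mxrank0.
have sB : B \in symmx F n.+2.
  rewrite mem_symmx (tr_block_mx (m1 := 1) (n1 := 1)).
  by rewrite (tr_block_mx (m1 := 1) (n1 := 1)) !trmx1 !trmx0 tr_scalar_mx.
exists B; rewrite inE; apply/andP; split; first by rewrite inE sB rB.
rewrite /symm_type rB /=; suff -> : hyperbolic B by [].
have s1 : (\rank B)./2 = 1%N by rewrite rB.
rewrite /hyperbolic s1.
pose e : 'rV[F]_(1 + (1 + n)) := row_mx 1%:M (row_mx 1%:M 0).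
pose f : 'rV[F]_(1 + (1 + n)) := row_mx (4^-1)%:M (row_mx (- 4^-1)%:M 0).
have nz4 : 4%:R != 0 :> F by rewrite (natrM _ 2 2) mulf_neq0.
have comb z t : z *: e + t *: f =
    row_mx (z + t / 4%:R)%:M (row_mx (z - t / 4%:R)%:M 0).
  rewrite !scale_row_mx !add_row_mx !scaler0 addr0 !scale_scalar_mx -!raddfD /=.
  by rewrite !mulr1 mulrN.
apply/existsP; exists e; apply/existsP; exists f; apply/andP; split.
  apply/row_subP => i; have [z [v ->]] := row_mx_scalarP (row i 1%:M).
  have [t [w ->]] := row_mx_scalarP v.
  have -> : row_mx z%:M (row_mx t%:M w) =
      ((z + t) / 2%:R) *: e + (2%:R * (z - t)) *: f + row_mx 0 (row_mx 0 w).
    rewrite comb !add_row_mx !addr0 add0r; congr (row_mx _%:M (row_mx _%:M _));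
      by field; rewrite nz4 two_neq0.
  apply: addmx_sub_adds; last first.
    by apply/sub_kermxP; rewrite /B /B0 !mul_row_block !(mulmx0, mul0mx, addr0, add0r, row_mx0).
  by rewrite -2!mul_scalar_mx -mul_row_col submxMl.
apply/forallP=> x; apply/forallP=> y.
rewrite [x]mx11_scalar [y]mx11_scalar !mul_scalar_mx comb !qform_block.
rewrite /qform mulmx0 mul0mx !mxE addr0 big_ord1 !mxE !eqxx !mulr1n.
by apply/eqP; field.
Qed.

End MinimumDistance.

Theorem theorem3p10 (F : finFieldType) (q_odd : odd #|F|)
    (m : nat) (m_ge2 : (2 <= m)%N) :
  (forall t : nat, (1 <= t)%N -> (2 * t <= m)%N ->
     exists d : nat, [/\ has_min_distance (Csymm F m (2 * t)) d,
       is_W F m 1 (2 * t) d & is_W F m 2 (2 * t) d]) /\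
  (forall t : nat, (2 * t + 1 <= m)%N ->
     exists d : nat, has_min_distance (Csymm F m (2 * t + 1)) d /\
       is_W_type F m 2 1%R (2 * t + 1) d).
Proof.
have [chi [chiD chiN chi_nt]] := additive_char_exists F.
case: m m_ge2 => [|[|n]] // _.
have [B hB] := symmx_hyperbolic_exists q_odd n.
have rkE k A : A \in symmx_rank F n.+2 k -> A \in symmx F n.+2 /\ \rank A = k.
  by rewrite inE => /andP[-> /eqP].
have tyE A : A \in symmx_rank_type F n.+2 2 1%R ->
    A \in symmx_rank F n.+2 2 /\ hyperbolic A.
  rewrite inE => /andP[rA]; have [_ rA2] := rkE _ _ rA.
  by rewrite /symm_type rA2 /=; case: (hyperbolic A).
have [rB _] := tyE _ hB; have [sB rkB] := rkE _ _ rB.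
have nzB : B != 0%R by rewrite -mxrank_eq0 rkB.
have hyp a A : A \in symmx_rank_type F n.+2 2 1%R ->
    char_sum chi a A = char_sum_max chi n a.
  move=> /tyE[/rkE[sA rA] hA].
  have [e Qe eA] := hyperbolic_isotropic sA rA hA.
  exact: (char_sum_rank2_isotropic q_odd chiD chiN chi_nt a sA rA Qe eA).
have bound a A : A \in symmx F n.+2 -> A != 0%R ->
    (char_sum chi a A <= char_sum chi a B)%R.
  move=> sA nzA; rewrite (hyp _ _ hB).
  have [r1 | r2] := leqP (\rank A) 1.
    rewrite char_sum_rank1 //; last first.
      by apply/eqP; rewrite eqn_leq r1 lt0n mxrank_eq0.
    by case: ifP => // _; apply: char_sum_max_ge0.
  apply: le_trans (char_sum_bound q_odd chiD chiN chi_nt a sA r2).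
  by apply: real_ler_norm; apply: char_sum_real.
split=> [t t_gt0 _ | t _].
  have ev : ~~ odd (2 * t) by rewrite mul2n odd_double.
  exists (hamming_weight (codeword (2 * t) B)); split.
  - apply: (min_distance_codeword q_odd chiD chiN chi_nt) (bound _) => //.
    by rewrite muln_gt0.
  - split; first exact: symmx_rank1_exists.
    move=> A /rkE[sA rA]; apply: (weight_eq chiD chiN chi_nt).
    by rewrite (hyp _ _ hB) char_sum_rank1 // (negPf ev).
  split; first by exists B.
  move=> A /rkE[sA rA]; apply: (weight_eq chiD chiN chi_nt).
  by rewrite (hyp _ _ hB) char_sum_rank2_even.
exists (hamming_weight (codeword (2 * t + 1) B)); split.
  apply: (min_distance_codeword q_odd chiD chiN chi_nt) (bound _) => //.
  by rewrite addn1.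
split; first by exists B.
by move=> A hA; apply: (weight_eq chiD chiN chi_nt); rewrite !hyp.
Qed.
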